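(* Let $n\ge 1$ be an integer and let $\alpha,\beta>0$. Let $Y_1,\dots,Y_n,Y_\alpha$ be mutually independent random variables with $Y_i\sim \mathcal{G}a(1)$ for $i=1,\dots,n$ and $Y_\alpha\sim\mathcal{G}a(\alpha)$, and let $X_i=\beta\, Y_i/Y_\alpha$ for $i=1,\dots,n$. Then the aggregate random variable $S_n=X_1+\dots+X_n$ has probability density function $$f_{S_n}(x;n,\alpha,\beta)=\frac{x^{n-1}}{\beta^n B(n,\alpha)(1+x/\beta)^{n+\alpha}},\quad x>0,$$ and $f_{S_n}(x;n,\alpha,\beta)=0$ if $x<0$; that is, $S_n\sim\mathcal{B}2(n,\alpha,\beta)$.
   Context: For $a>0$, $\mathcal{G}a(a)$ denotes the gamma distribution with probability density function $x^{a-1}e^{-x}/\Gamma(a)$ for $x>0$ (so $\mathcal{G}a(1)$ is the exponential distribution with mean $1$). $B(p,q)=\Gamma(p)\Gamma(q)/\Gamma(p+q)$ is the beta function. For $p,q,\beta>0$, the second kind beta distribution $\mathcal{B}2(p,q,\beta)$ is the distribution with density $\frac{x^{p-1}}{\beta^pB(p,q)(1+x/\beta)^{p+q}}$ for $x>0$ and $0$ for $x<0$. *)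

(* Defs.v *)
From mathcomp Require Import all_boot all_order all_algebra.
From mathcomp Require Import all_classical all_reals all_analysis.

Set Implicit Arguments.
Unset Strict Implicit.
Unset Printing Implicit Defensive.

Import Order.TTheory GRing.Theory Num.Theory.
Import numFieldNormedType.Exports.

Local Open Scope classical_set_scope.
Local Open Scope ring_scope.

(* Euler's gamma function, meaningful for 0 < a (where the integral is finite). *)
Definition Gamma {R : realType} (a : R) : R :=
  \int[@lebesgue_measure R]_(t in `]0, +oo[) (t `^ (a - 1) * expR (- t)).

(* The library's [beta_fun] only takes natural numbers as arguments. *)
Definition Beta {R : realType} (p q : R) : R :=
  Gamma p * Gamma q / Gamma (p + q).

(* Both densities below are given the value 0 at the origin, where the usual
   formulas leave them unspecified; this does not affect the distribution. *)
Definition gamma_pdf {R : realType} (a x : R) : R :=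
  if 0 < x then x `^ (a - 1) * expR (- x) / Gamma a else 0.

Definition beta2_pdf {R : realType} (p q beta x : R) : R :=
  if 0 < x then
    x `^ (p - 1) / (beta `^ p * Beta p q * (1 + x / beta) `^ (p + q))
  else 0.

(* [X] is a bare function so that the predicate applies directly to pointwise
   expressions in random variables; its measurability is part of the claim. *)
Definition has_pdf d (T : measurableType d) (R : realType)
    (P : probability T R) (X : T -> R) (f : R -> R) : Prop :=
  [/\ measurable_fun [set: T] X,
      measurable_fun [set: R] f,
      forall x, 0 <= f x &
      forall A : set R, measurable A ->
        pushforward P X A =
        (\int[@lebesgue_measure R]_(x in A) (f x)%:E)%E].

(* Product rule over every finite subfamily [J]. *)
Definition mutually_independent d (T : measurableType d) (R : realType)
    (P : probability T R) (I : finType) (X : I -> {RV P >-> R}) : Prop :=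
  forall (J : {set I}) (A : I -> set R),
    (forall i, i \in J -> measurable (A i)) ->
    P (\bigcap_(i in [set` J]) X i @^-1` A i) =
    (\prod_(i in J) P (X i @^-1` A i))%E.

(* Main.v *)
(**
The sum of independent Ga(a) and Ga(b) variables has at z > 0 the density
z^(a+b-1) e^-z times a constant, by the substitution x = z t in the
convolution. The constant need not be computed: the total mass being 1, it has
to be 1 / Gamma(a+b), which also shows that Gamma(a+b) is finite and positive.
Hence W = Y_1 + ... + Y_n is Ga(n). As W is independent of Y_alpha, the
substitution w = (y / beta) t followed by Tonelli gives the density
    t |-> \int (y / beta) f_alpha(y) f_W(y t / beta) dy
for beta W / Y_alpha; it is a gamma integral in (1 + t / beta) y, whose value is
the second kind beta density.
*)
From HB Require Import structures.
Require Import Defs.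
From mathcomp Require Import all_boot all_order all_algebra.
From mathcomp Require Import all_classical all_reals all_analysis.
From mathcomp Require Import measurable_realfun ring lra.

Set Implicit Arguments.
Unset Strict Implicit.
Unset Printing Implicit Defensive.

Import Order.TTheory GRing.Theory Num.Theory.
Import numFieldNormedType.Exports.

Local Open Scope classical_set_scope.
Local Open Scope ring_scope.

(** * Measurability of the inverse, image measures and affine substitution *)

(** The inverse is glued from powers of exponent -1 on the two sides of 0. At 0 the conventions
    agree: the inverse and the power are both 0. *)
Lemma measurable_inv (R : realType) : measurable_fun [set: R] (@GRing.inv R).
Proof.
rewrite (_ : GRing.inv = fun x : R =>
    if 0 < x then x `^ (-1) else - ((- x) `^ (-1))); last first.
  apply/funext => x; case: ltrP => [x0|x0].
    by rewrite powR_inv1// ltW.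
  by rewrite powR_inv1 ?oppr_ge0// invrN opprK.
apply: measurable_fun_ifT; first exact: measurable_fun_ltr.
  exact: measurable_powR.
apply: measurableT_comp => //.
by apply: (measurableT_comp (measurable_powR _)).
Qed.

(* The pushforward as a bundled measure: canonical inference alone cannot supply
   the measurability proof. *)
Definition image_measure d1 d2 (T1 : measurableType d1) (T2 : measurableType d2)
    (R : realFieldType) (mu : {measure set T1 -> \bar R}) (phi : T1 -> T2)
    (mphi : measurable_fun [set: T1] phi) : {measure set T2 -> \bar R} :=
  measure_function_pushforward__canonical__measure_function_Measure mu mphi.
Arguments image_measure {d1 d2 T1 T2 R} mu {phi} mphi.

(** The image of Lebesgue measure under x |-> a x + b, scaled by a, gives each half-open interval
    its length, so it is Lebesgue measure by uniqueness. Integrating F against it yields the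
    formula. *)
Lemma ge0_integral_affine (R : realType) (a b : R) (F : R -> \bar R) :
  0 < a -> measurable_fun [set: R] F -> (forall x, (0 <= F x)%E) ->
  (\int[@lebesgue_measure R]_x F x =
   a%:E * \int[@lebesgue_measure R]_x F (a * x + b)%R)%E.
Proof.
move=> a0 mF F0.
pose phi (x : measurableTypeR R) : measurableTypeR R := a * x + b.
have mphi : measurable_fun [set: measurableTypeR R] phi.
  by apply: measurable_funD => //; exact: measurable_funM.
pose nu : {measure set (measurableTypeR R) -> \bar R} :=
  mscale (NngNum (ltW a0)) (image_measure (@lebesgue_measure R) mphi).
have nuE A : measurable A -> lebesgue_measure A = nu A.
  apply: lebesgue_measure_unique => _ [[p q] _ <-] /=.
  rewrite /nu/= /mscale/= /pushforward.
  rewrite (_ : phi @^-1` _ = `](p - b) / a, (q - b) / a]%classic); last first.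
    apply/seteqP; split => x /=; rewrite !in_itv/= /phi ltr_pdivrMr//
      ler_pdivlMr// ltrBlDr lerBrDr [x * a]mulrC //.
  rewrite !lebesgue_measure_itv/= !lte_fin ltr_pM2r ?invr_gt0// ltrD2r.
  case: ifPn => _; last by rewrite mule0.
  by rewrite -!EFinB -EFinM; congr (_%:E); field; rewrite gt_eqF.
rewrite (eq_measure_integral nu); last by move=> A mA _; exact: nuE.
rewrite ge0_integral_mscale//; congr (_ * _)%E.
by rewrite ge0_integral_pushforward.
Qed.

(** * Measures given by a density, and uniqueness of finite measures on a product *)

Section density.
Context d (T : measurableType d) (R : realType).
Variables (mu : {measure set T -> \bar R}) (f : T -> R).
Hypotheses (mf : measurable_fun [set: T] f) (f0 : forall x, 0 <= f x).

Let nu (A : set T) : \bar R := (\int[mu]_(x in A) (f x)%:E)%E.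

Let nu0 : nu set0 = 0%E.
Proof. exact: integral_set0. Qed.

Let nu_ge0 A : (0 <= nu A)%E.
Proof. by apply: integral_ge0 => x _; rewrite lee_fin. Qed.

Let nu_sigma_additive : semi_sigma_additive nu.
Proof.
move=> A mA tA mUA; rewrite /nu ge0_integral_bigcup//; last 2 first.
- by apply/measurable_EFinP; exact: measurable_funTS.
- by move=> x _; rewrite lee_fin.
apply: is_cvg_ereal_nneg_natsum_cond => n _ _.
by apply: integral_ge0 => x _; rewrite lee_fin.
Qed.

HB.instance Definition _ := isMeasure.Build _ _ _ nu nu0 nu_ge0
  nu_sigma_additive.

Definition density_measure : {measure set T -> \bar R} := nu.

End density.
Arguments density_measure {d T R} mu {f} mf f0.

(** Measurable rectangles are stable under intersection, generate the product sigma-algebra and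
    include the whole space. As the latter has finite mass, the constant sequence [setT] serves as
    exhaustion in the uniqueness theorem. *)
Lemma eq_finite_measure_prod d1 d2 (T1 : measurableType d1)
    (T2 : measurableType d2) (R : realType)
    (m1 m2 : {measure set (T1 * T2) -> \bar R}) :
  (m1 setT < +oo)%E ->
  (forall A B, measurable A -> measurable B -> m1 (A `*` B) = m2 (A `*` B)) ->
  forall C, measurable C -> m1 C = m2 C.
Proof.
move=> m1T m12 C mC.
apply: (measure_unique [set A `*` B | A in measurable & B in measurable]
  (fun=> setT)) => //.
- exact: measurable_prod_measurableType.
- move=> _ _ [A mA [B mB <-]] [A' mA' [B' mB' <-]].
  exists (A `&` A'); first exact: measurableI.
  by exists (B `&` B'); [exact: measurableI|rewrite setXI].
- by move=> _; exists setT => //; exists setT => //; rewrite setXTT.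
- exact: bigcup_const.
- by move=> _ [A mA [B mB <-]]; exact: m12.
Qed.

(** * From rectangles to arbitrary events of a pair of variables *)

(** As functions of [C], both sides are finite measures: the images under (U, V) of [P] restricted
    to [E] and of [P] scaled by [P E]. The hypothesis says that they agree on rectangles. *)
Lemma indep_pair_event d (T : measurableType d) (R : realType)
    (P : probability T R) (U V : T -> R) (E : set T) (C : set (R * R)) :
  measurable_fun [set: T] U -> measurable_fun [set: T] V -> measurable E ->
  (forall A B : set R, measurable A -> measurable B ->
    P (U @^-1` A `&` V @^-1` B `&` E) =
    (P (U @^-1` A `&` V @^-1` B) * P E)%E) ->
  measurable C ->
  P ((fun w => (U w, V w)) @^-1` C `&` E) =
  (P ((fun w => (U w, V w)) @^-1` C) * P E)%E.
Proof.
move=> mU mV mE UVE mC.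
have mUV := measurable_fun_pair mU mV.
have PEfin : P E \is a fin_num by exact: fin_num_measure.
pose m1 : {measure set _ -> \bar R} :=
  image_measure (mrestr P mE) mUV.
pose m2 : {measure set _ -> \bar R} :=
  mscale (NngNum (fine_ge0 (measure_ge0 P E)))
    (image_measure P mUV).
have m2E X : m2 X = (P ((fun w => (U w, V w)) @^-1` X) * P E)%E.
  by rewrite /m2/= /mscale/= /pushforward fineK// muleC.
rewrite -m2E -[LHS]/(m1 C); apply: eq_finite_measure_prod => //.
  rewrite /m1/= /image_measure/= /pushforward /mrestr preimage_setT setTI.
  by rewrite ltey_eq PEfin.
move=> A B mA mB; rewrite m2E /m1/= /image_measure/= /pushforward /mrestr.
exact: UVE.
Qed.

(** The law of (U, V) and the measure with density f x * g y agree on rectangles, hence everywhere;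
    Tonelli turns the integral over the product into an iterated one. *)
Lemma joint_pdf d (T : measurableType d) (R : realType)
    (P : probability T R) (U V : T -> R) (f g : R -> R) (C : set (R * R)) :
  has_pdf P U f -> has_pdf P V g ->
  (forall A B : set R, measurable A -> measurable B ->
    P (U @^-1` A `&` V @^-1` B) = (P (U @^-1` A) * P (V @^-1` B))%E) ->
  measurable C ->
  P ((fun w => (U w, V w)) @^-1` C) =
  (\int[@lebesgue_measure R]_x \int[@lebesgue_measure R]_y
    (f x * g y * \1_C (x, y))%:E)%E.
Proof.
move=> [mU mf f0 Uf] [mV mg g0 Vg] UV mC.
(* [lebesgue_measure] lives on [measurableTypeR R], which is convertible to [R]
   but has another display, so the product has to be taken there. *)
have mUV : measurable_fun [set: T]
    (fun w => (U w, V w) : measurableTypeR R * measurableTypeR R).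
  exact: measurable_fun_pair mU mV.
pose h (z : measurableTypeR R * measurableTypeR R) : R := f z.1 * g z.2.
have mh : measurable_fun setT h.
  apply: measurable_funM; first exact: (measurableT_comp mf).
  exact: (measurableT_comp mg).
have h0 z : 0 <= h z by rewrite mulr_ge0.
pose m1 : {measure set (measurableTypeR R * measurableTypeR R) -> \bar R} :=
  image_measure P mUV.
pose m2 : {measure set (measurableTypeR R * measurableTypeR R) -> \bar R} :=
  density_measure (@lebesgue_measure R \x @lebesgue_measure R)%E mh h0.
have m2E X : measurable X -> m2 X =
  (\int[@lebesgue_measure R]_x \int[@lebesgue_measure R]_y
    (f x * g y * \1_X (x, y))%:E)%E.
  move=> mX; rewrite /m2/= /density_measure integral_mkcond.
  rewrite -[X in integral _ _ X]/(((EFin \o h) \_ X)) restrict_EFin patch_indic.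
  rewrite fubini_tonelli1//;
    first (by apply/measurable_EFinP; apply: measurable_funM).
  by move=> z; rewrite /= lee_fin mulr_ge0// indicE ler0n.
rewrite -m2E// -[LHS]/(m1 C); apply: eq_finite_measure_prod => //.
  rewrite /m1/= /image_measure/= /pushforward preimage_setT.
  by rewrite probability_setT ltry.
move=> A B mA mB; rewrite m2E; last exact: measurableX.
rewrite [LHS](UV A B)// -[P (U @^-1` A)]/(pushforward P U A) Uf//.
rewrite -[P (V @^-1` B)]/(pushforward P V B) Vg//.
(* Domains of integration become indicator factors: the indicator of a rectangle is a product, so
   the iterated integral factors. *)
have mkA (k : R -> R) (D : set R) :
    (\int[@lebesgue_measure R]_(x in D) (k x)%:E =
     \int[@lebesgue_measure R]_x (k x * \1_D x)%:E)%E.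
  rewrite integral_mkcond -[X in integral _ _ X]/((EFin \o k) \_ D).
  by rewrite restrict_EFin patch_indic.
have mM (k : R -> R) (D : set R) : measurable_fun [set: R] k -> measurable D ->
    measurable_fun [set: R] (fun x => (k x * \1_D x)%:E).
  move=> mk mD; apply/measurable_EFinP; exact: measurable_funM.
have ge0M (k : R -> R) (D : set R) x : (forall x, 0 <= k x) ->
    (0 <= (k x * \1_D x)%:E)%E.
  by move=> k0; rewrite lee_fin mulr_ge0// indicE ler0n.
rewrite (mkA f) (mkA g) -ge0_integralZr//; [|exact: mM
  | by move=> x _; exact: ge0M | by apply: integral_ge0 => x _; exact: ge0M].
apply: eq_integral => x _; rewrite -ge0_integralZl//; [|exact: mM
  | by move=> y _; exact: ge0M | exact: ge0M].
apply: eq_integral => y _; rewrite -EFinM; congr (_%:E).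
rewrite !indicE in_setX/= -mulnb natrM; ring.
Qed.

(** * Laws of a sum and of a ratio of independent variables *)

Lemma law_add d (T : measurableType d) (R : realType)
    (P : probability T R) (U V : T -> R) (f g : R -> R) (A : set R) :
  has_pdf P U f -> has_pdf P V g ->
  (forall A B : set R, measurable A -> measurable B ->
    P (U @^-1` A `&` V @^-1` B) = (P (U @^-1` A) * P (V @^-1` B))%E) ->
  measurable A ->
  P ((fun w => U w + V w) @^-1` A) =
  (\int[@lebesgue_measure R]_(z in A) \int[@lebesgue_measure R]_x
    (f x * g (z - x))%:E)%E.
Proof.
move=> Uf Vg UV mA; have [_ mf f0 _] := Uf; have [_ mg g0 _] := Vg.
have mI : measurable_fun [set: R] (\1_A : R -> R) by exact: measurable_indic.
pose C := (fun z : R * R => z.1 + z.2) @^-1` A.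
have mC : measurable C.
  by rewrite -[C]setTI; apply: (@measurable_funD _ _ _ _ fst snd).
rewrite -[LHS]/(P ((fun w => (U w, V w)) @^-1` C)) (joint_pdf Uf Vg UV mC).
pose h (x z : measurableTypeR R) : R := f x * g (z - x) * \1_A z.
have h0 x z : 0 <= h x z by rewrite /h mulr_ge0 ?mulr_ge0// indicE ler0n.
have mh : measurable_fun [set: measurableTypeR R * measurableTypeR R]
    (fun z => h z.1 z.2).
  apply: measurable_funM; last exact: (measurableT_comp mI).
  apply: measurable_funM; first exact: (measurableT_comp mf).
  apply: (measurableT_comp mg); exact: measurable_funB.
(* At fixed x, the inner variable is translated by y = z - x; Tonelli then puts z outside. *)
transitivity (\int[@lebesgue_measure R]_x
    \int[@lebesgue_measure R]_z (h x z)%:E)%E.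
  apply: eq_integral => x _.
  rewrite (ge0_integral_affine (- x) ltr01)//.
  - rewrite mul1e; apply: eq_integral => z _; congr (_%:E).
    by rewrite mul1r -[\1_C _]/(\1_A (x + (z - x))) subrKC.
  - apply/measurable_EFinP; apply: measurable_funM.
      exact: measurable_funM.
    apply: (measurableT_comp mI (g := fun y => x + y)).
    exact: measurable_funD.
  - by move=> y; rewrite lee_fin mulr_ge0 ?mulr_ge0// indicE ler0n.
rewrite (@fubini_tonelli _ _ _ _ _ _ _ (fun z => (h z.1 z.2)%:E))//=;
  last 2 first.
- exact/measurable_EFinP.
- by move=> z; rewrite lee_fin.
rewrite [RHS]integral_mkcond; apply: eq_integral => z _.
rewrite patchE; case: ifPn => zA.
  by apply: eq_integral => x _; rewrite /h indicE zA mulr1.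
by apply: integral0_eq => x _; rewrite /h indicE (negbTE zA) mulr0.
Qed.

Lemma law_ratio d (T : measurableType d) (R : realType)
    (P : probability T R) (U V : T -> R) (f g : R -> R) (beta : R)
    (A : set R) :
  0 < beta -> (forall x, x <= 0 -> f x = 0) ->
  has_pdf P U f -> has_pdf P V g ->
  (forall A B : set R, measurable A -> measurable B ->
    P (U @^-1` A `&` V @^-1` B) = (P (U @^-1` A) * P (V @^-1` B))%E) ->
  measurable A ->
  P ((fun w => beta * V w / U w) @^-1` A) =
  (\int[@lebesgue_measure R]_(t in A) \int[@lebesgue_measure R]_x
    (x / beta * f x * g (x / beta * t))%:E)%E.
Proof.
move=> beta0 fneg Uf Vg UV mA; have [_ mf f0 _] := Uf; have [_ mg g0 _] := Vg.
have mI : measurable_fun [set: R] (\1_A : R -> R) by exact: measurable_indic.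
pose C := (fun z : R * R => beta * z.2 / z.1) @^-1` A.
have mC : measurable C.
  rewrite -[C]setTI.
  have : measurable_fun [set: R * R] (fun z : R * R => beta * z.2 / z.1).
    apply: measurable_funM; first exact: measurable_funM.
    exact: (measurableT_comp (@measurable_inv R)).
  exact.
rewrite -[LHS]/(P ((fun w => (U w, V w)) @^-1` C)) (joint_pdf Uf Vg UV mC).
pose h (x t : measurableTypeR R) : R :=
  x / beta * f x * g (x / beta * t) * \1_A t.
(* The factor x / beta is negative for x < 0, but [f] vanishes there. *)
have h0 x z : 0 <= h x z.
  rewrite /h; apply: mulr_ge0; last by rewrite indicE ler0n.
  apply: mulr_ge0 => //; case: (leP x 0) => [/fneg ->|x0].
    by rewrite mulr0.
  by rewrite mulr_ge0// divr_ge0// ltW.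
have mh : measurable_fun [set: measurableTypeR R * measurableTypeR R]
    (fun z => h z.1 z.2).
  apply: measurable_funM; last exact: (measurableT_comp mI).
  apply: measurable_funM.
    apply: measurable_funM; first exact: measurable_funM.
    exact: (measurableT_comp mf).
  apply: (measurableT_comp mg).
  by apply: measurable_funM => //; exact: measurable_funM.
(* Both inner integrals vanish for x <= 0. For x > 0, y = (x / beta) t is an increasing
   substitution, under which the ratio beta y / x becomes t. *)
transitivity (\int[@lebesgue_measure R]_x
    \int[@lebesgue_measure R]_z (h x z)%:E)%E.
  apply: eq_integral => x _.
  case: (leP x 0) => [/fneg fx0|x0].
    rewrite !integral0_eq// => t _.
      by rewrite /h fx0 mulr0 !mul0r.
    by rewrite fx0 !mul0r.
  have xb0 : 0 < x / beta by rewrite divr_gt0.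
  pose k (y : R) : R := f x * g y * \1_A (beta * y / x).
  have k0 y : 0 <= k y by rewrite mulr_ge0 ?mulr_ge0// indicE ler0n.
  have mk : measurable_fun [set: R] (EFin \o k).
    apply/measurable_EFinP; apply: measurable_funM.
      exact: measurable_funM.
    apply: (measurableT_comp mI (g := fun y => beta * y / x)).
    by apply: measurable_funM => //; exact: measurable_funM.
  rewrite -[LHS]/(\int[@lebesgue_measure R]_y (EFin \o k) y)%E.
  rewrite (ge0_integral_affine 0 xb0)//.
  rewrite -ge0_integralZl//; last 3 first.
  - apply: (measurableT_comp mk (g := fun t => x / beta * t + 0)).
    by apply: measurable_funD => //; exact: measurable_funM.
  - by move=> t _; rewrite lee_fin.
  - by rewrite lee_fin ltW.
  apply: eq_integral => t _; rewrite -EFinM; congr (_%:E).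
  rewrite /k addr0 [beta * _ / x](_ : _ = t); first by rewrite /h; ring.
  by field; rewrite !gt_eqF.
rewrite (@fubini_tonelli _ _ _ _ _ _ _ (fun z => (h z.1 z.2)%:E))//=;
  last 2 first.
- exact/measurable_EFinP.
- by move=> z; rewrite lee_fin.
rewrite [RHS]integral_mkcond; apply: eq_integral => z _.
rewrite patchE; case: ifPn => zA.
  by apply: eq_integral => x _; rewrite /h indicE zA mulr1.
by apply: integral0_eq => x _; rewrite /h indicE (negbTE zA) mulr0.
Qed.

(** * Gamma densities: normalisation, sums and ratios *)

(** The unnormalised gamma density, extended by 0 so that substitutions take place on the whole
    line. It allows computing before [Gamma a] is known to be finite. *)
Definition gamma_kernel {R : realType} (a x : R) : R :=
  if 0 < x then x `^ (a - 1) * expR (- x) else 0.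

Section gamma_kernel.
Context (R : realType).
Implicit Types (a x : R).

Lemma gamma_kernel_ge0 a x : 0 <= gamma_kernel a x.
Proof.
rewrite /gamma_kernel; case: ifP => // _.
by rewrite mulr_ge0 ?powR_ge0 ?expR_ge0.
Qed.

Lemma measurable_gamma_kernel a : measurable_fun [set: R] (gamma_kernel a).
Proof.
apply: measurable_fun_ifT => //; first exact: measurable_fun_ltr.
apply: measurable_funM; first exact: measurable_powR.
exact: (measurableT_comp (@measurable_expR R)).
Qed.

Lemma gamma_pdfE a x : gamma_pdf a x = gamma_kernel a x / Gamma a.
Proof. by rewrite /gamma_pdf /gamma_kernel; case: ifP; rewrite ?mul0r. Qed.

Lemma Gamma_kernel a :
  Gamma a = fine (\int[@lebesgue_measure R]_x (gamma_kernel a x)%:E)%E.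
Proof.
rewrite /Gamma /Rintegral integral_mkcond; congr fine.
apply: eq_integral => x _; rewrite patchE /gamma_kernel.
by rewrite mem_setE in_itv/= andbT; case: ifP.
Qed.

Lemma integral_gamma_kernel_ge0 a :
  (0 <= \int[@lebesgue_measure R]_x (gamma_kernel a x)%:E)%E.
Proof. by apply: integral_ge0 => x _; rewrite lee_fin gamma_kernel_ge0. Qed.

Lemma Gamma_ge0 a : 0 <= Gamma a.
Proof. by rewrite Gamma_kernel fine_ge0// integral_gamma_kernel_ge0. Qed.

(** Since [fine] sends infinities to 0, positivity of [Gamma a] certifies that the integral is
    finite. *)
Lemma integral_gamma_kernel a : 0 < Gamma a ->
  (\int[@lebesgue_measure R]_x (gamma_kernel a x)%:E)%E = (Gamma a)%:E.
Proof.
by rewrite Gamma_kernel; case: (integral _ _ _) => //=; rewrite ltxx.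
Qed.

(* Were Gamma a zero or infinite (hence 0 by [fine]), [gamma_pdf a] would be 0. *)
Lemma has_pdf_gamma_Gamma_gt0 d (T : measurableType d) (P : probability T R)
    (U : T -> R) a : has_pdf P U (gamma_pdf a) -> 0 < Gamma a.
Proof.
move=> [_ _ _ /(_ setT measurableT)].
rewrite /pushforward preimage_setT probability_setT => PT.
rewrite lt_neqAle Gamma_ge0 andbT; apply/eqP => Ga0; move: PT.
rewrite integral0_eq => [/eqP|x _]; first by rewrite onee_eq0.
by rewrite gamma_pdfE -Ga0 invr0 mulr0.
Qed.

Lemma measurable_gamma_pdf a : measurable_fun [set: R] (gamma_pdf a).
Proof.
rewrite (_ : gamma_pdf a = fun x => gamma_kernel a x / Gamma a); last first.
  by apply/funext => x; exact: gamma_pdfE.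
by apply: measurable_funM => //; exact: measurable_gamma_kernel.
Qed.

Lemma gamma_pdf_ge0 a x : 0 <= gamma_pdf a x.
Proof. by rewrite gamma_pdfE divr_ge0 ?gamma_kernel_ge0 ?Gamma_ge0. Qed.

(** After x = z t, all dependence on z comes out as z^(a-1) z^(b-1) e^-z times the Jacobian z. The
    product is taken in the extended reals because the integral over t is not yet known to be
    finite. *)
Lemma gamma_convolution a b z :
  (\int[@lebesgue_measure R]_x (gamma_pdf a x * gamma_pdf b (z - x))%:E =
   (\int[@lebesgue_measure R]_(t in `]0%R, 1%R[)
      (t `^ (a - 1) * (1 - t) `^ (b - 1) / (Gamma a * Gamma b))%:E) *
   (gamma_kernel (a + b) z)%:E)%E.
Proof.
(* For z <= 0, x and z - x cannot both be positive, so both sides are 0. *)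
case: (leP z 0) => z0.
  rewrite [in RHS]/gamma_kernel ltNge z0/= mule0 integral0_eq// => x _.
  rewrite !gamma_pdfE /gamma_kernel; case: ltP => x0; last by rewrite !mul0r.
  by rewrite ltNge (_ : z - x <= 0)/= ?mul0r ?mulr0//; lra.
rewrite (ge0_integral_affine 0 z0); last 2 first.
- apply/measurable_EFinP; apply: measurable_funM.
    exact: measurable_gamma_pdf.
  apply: (measurableT_comp (measurable_gamma_pdf b)); exact: measurable_funB.
- by move=> x; rewrite lee_fin mulr_ge0 ?gamma_pdf_ge0.
rewrite [in RHS]integral_mkcond.
have mk : measurable_fun [set: R] (fun t : R =>
    t `^ (a - 1) * (1 - t) `^ (b - 1) / (Gamma a * Gamma b)).
  apply: measurable_funM => //; apply: measurable_funM.
    exact: measurable_powR.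
  apply: (measurableT_comp (measurable_powR _)); exact: measurable_funB.
have k0 (t : R) : 0 <= t `^ (a - 1) * (1 - t) `^ (b - 1) / (Gamma a * Gamma b).
  by rewrite divr_ge0 ?mulr_ge0 ?powR_ge0 ?Gamma_ge0.
rewrite -ge0_integralZl//; last 3 first.
- apply/measurable_EFinP; apply: measurable_funM.
    apply: (measurableT_comp (measurable_gamma_pdf a)).
    by apply: measurable_funD => //; exact: measurable_funM.
  apply: (measurableT_comp (measurable_gamma_pdf b)).
  apply: measurable_funB => //.
  by apply: measurable_funD => //; exact: measurable_funM.
- by move=> x _; rewrite lee_fin mulr_ge0 ?gamma_pdf_ge0.
- by rewrite lee_fin ltW.
rewrite -[in RHS]ge0_integralZr//; last 3 first.
- apply/(measurable_restrictT _ _).1 => //.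
  by apply/measurable_EFinP; exact: measurable_funTS.
- by move=> x _; apply: erestrict_ge0 => t _; rewrite lee_fin.
- by rewrite lee_fin gamma_kernel_ge0.
apply: eq_integral => t _; rewrite patchE mem_setE in_itv/= addr0.
have -> : z - z * t = z * (1 - t) by ring.
rewrite !gamma_pdfE /gamma_kernel z0 !(pmulr_rgt0 _ z0) subr_gt0.
(* A restricted function takes the default value [point] off its domain, which is 0 in the extended
   reals. *)
rewrite -[point]/0%E.
case: ltP => t0 /=; last by rewrite !mul0r mule0 mul0e.
case: ltP => t1 /=; last by rewrite !mul0r mulr0 mule0 mul0e.
rewrite -!EFinM; congr (_%:E).
rewrite !powRM ?subr_ge0 ?ltW//.
have zD r s : z `^ (r + s) = z `^ r * z `^ s.
  by apply: powRD; rewrite (gt_eqF z0) implybT.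
have -> : z `^ (a + b - 1) = z * (z `^ (a - 1) * z `^ (b - 1)).
  by rewrite -[X in X * _]powRr1 ?ltW// -!zD; congr (_ `^ _); ring.
rewrite (_ : - z = - (z * t) + - (z * (1 - t))); last by ring.
rewrite expRD invfM; ring.
Qed.

Lemma has_pdf_gammaD d (T : measurableType d) (P : probability T R)
    (U V : T -> R) a b :
  has_pdf P U (gamma_pdf a) -> has_pdf P V (gamma_pdf b) ->
  (forall A B : set R, measurable A -> measurable B ->
    P (U @^-1` A `&` V @^-1` B) = (P (U @^-1` A) * P (V @^-1` B))%E) ->
  has_pdf P (fun w => U w + V w) (gamma_pdf (a + b)).
Proof.
move=> Ua Vb UV; have [mU _ _ _] := Ua; have [mV _ _ _] := Vb.
have mG x : measurable_fun [set: R] (EFin \o gamma_kernel x).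
  by apply/measurable_EFinP; exact: measurable_gamma_kernel.
split; [exact: measurable_funD|exact: measurable_gamma_pdf|exact: gamma_pdf_ge0|].
set c := (\int[@lebesgue_measure R]_(t in `]0%R, 1%R[)
  (t `^ (a - 1) * (1 - t) `^ (b - 1) / (Gamma a * Gamma b))%:E)%E.
have c0 : (0 <= c)%E.
  apply: integral_ge0 => t _.
  by rewrite lee_fin divr_ge0 ?mulr_ge0 ?powR_ge0 ?Gamma_ge0.
have lawE (A : set R) : measurable A -> P ((fun w => U w + V w) @^-1` A) =
    (c * \int[@lebesgue_measure R]_(z in A) (gamma_kernel (a + b) z)%:E)%E.
  move=> mA; rewrite (law_add Ua Vb UV mA) -ge0_integralZl//; last 2 first.
  - exact: (measurable_funTS (mG (a + b))).
  - by move=> z _; rewrite lee_fin gamma_kernel_ge0.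
  by apply: eq_integral => z _; rewrite gamma_convolution.
(* The total mass gives 1 = c * G in the extended reals, G being the integral of the kernel. An
   infinite factor would make the product 0 or infinite, so both are finite and nonzero. *)
have [G0 cE] : 0 < Gamma (a + b) /\ c = ((Gamma (a + b))^-1)%:E.
  have := lawE _ measurableT; rewrite preimage_setT probability_setT.
  rewrite Gamma_kernel; have := integral_gamma_kernel_ge0 (a + b).
  move: c c0 {lawE} => [c| |]; case: (integral _ _ _) => [G| |] //=;
    rewrite ?lee_fin.
  - move=> c0 G0 [] cG.
    have Gneq0 : G != 0.
      by apply/eqP => G0'; move/eqP: cG; rewrite G0' mulr0 oner_eq0.
    split; first by rewrite lt_neqAle eq_sym Gneq0.
    by congr (_%:E); rewrite -[RHS]mul1r cG mulfK.
  - move=> c0 _; have [->|cn0] := eqVneq c 0;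
      first by rewrite mul0e => -[] /eqP; rewrite oner_eq0.
    by rewrite gt0_muley// lte_fin lt_neqAle eq_sym cn0.
  - move=> _ G0; have [->|Gn0] := eqVneq G 0;
      first by rewrite mule0 => -[] /eqP; rewrite oner_eq0.
    by rewrite gt0_mulye// lte_fin lt_neqAle eq_sym Gn0.
move=> A mA; rewrite /pushforward lawE// cE -ge0_integralZl//; last 3 first.
- exact: (measurable_funTS (mG (a + b))).
- by move=> z _; rewrite lee_fin gamma_kernel_ge0.
- by rewrite lee_fin invr_ge0 ltW.
by apply: eq_integral => z _; rewrite gamma_pdfE mulrC.
Qed.

Lemma has_pdf_gamma_ratio d (T : measurableType d) (P : probability T R)
    (U V : T -> R) (a b beta : R) :
  0 < beta ->
  has_pdf P U (gamma_pdf a) -> has_pdf P V (gamma_pdf b) ->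
  (forall A B : set R, measurable A -> measurable B ->
    P (U @^-1` A `&` V @^-1` B) = (P (U @^-1` A) * P (V @^-1` B))%E) ->
  has_pdf P (fun w => beta * V w / U w) (beta2_pdf b a beta).
Proof.
move=> beta0 Ua Vb UV; have [mU _ _ _] := Ua; have [mV _ _ _] := Vb.
(* The sum U + V is used only here: having [gamma_pdf (a + b)] as density forces this normalising
   constant to be positive. *)
have Gba : 0 < Gamma (b + a).
  rewrite addrC; exact: (has_pdf_gamma_Gamma_gt0 (has_pdf_gammaD Ua Vb UV)).
have [Ga Gb] := (has_pdf_gamma_Gamma_gt0 Ua, has_pdf_gamma_Gamma_gt0 Vb).
have Beta0 : 0 < Beta b a by rewrite /Beta divr_gt0// mulr_gt0.
split.
- apply: measurable_funM; first exact: measurable_funM.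
  exact: (measurableT_comp (@measurable_inv R)).
- apply: measurable_fun_ifT => //; first exact: measurable_fun_ltr.
  apply: measurable_funM; first exact: measurable_powR.
  apply: (measurableT_comp (@measurable_inv R)); apply: measurable_funM => //.
  apply: (measurableT_comp (measurable_powR _)).
  by apply: measurable_funD => //; exact: measurable_funM.
- move=> x; rewrite /beta2_pdf; case: ifPn => // x0.
  by rewrite divr_ge0 ?powR_ge0// mulr_ge0 ?powR_ge0// mulr_ge0 ?powR_ge0//
    ltW.
move=> A mA; rewrite /pushforward.
rewrite (law_ratio beta0 _ Ua Vb UV mA); last first.
  by move=> x x0; rewrite /gamma_pdf ltNge x0.
apply: eq_integral => t _; rewrite /beta2_pdf.
case: (ltP 0 t) => t0; last first.
  rewrite integral0_eq// => x _; rewrite /gamma_pdf.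
  case: (ltP 0 x) => x0; last by rewrite mulr0 mul0r.
  by rewrite ltNge mulr_ge0_le0 ?mulr0// ltW// divr_gt0.
have c0 : 0 < 1 + t / beta by rewrite ltr_pwDl// divr_ge0 ?ltW.
(* [k] gathers the factors free of x; its last divisor cancels the power of 1 + t / beta that
   appears when the kernel is evaluated at (1 + t / beta) x. *)
pose k := t `^ (b - 1) / (beta `^ b * (Gamma a * Gamma b)) /
  (1 + t / beta) `^ (b + a - 1).
have k0 : 0 <= k by rewrite !divr_ge0 ?powR_ge0// !mulr_ge0 ?powR_ge0// ltW.
transitivity (\int[@lebesgue_measure R]_x
    (k%:E * (gamma_kernel (b + a) ((1 + t / beta) * x + 0))%:E))%E.
  apply: eq_integral => x _; rewrite addr0 -EFinM; congr (_%:E).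
  rewrite !gamma_pdfE /gamma_kernel (pmulr_rgt0 _ c0).
  case: (ltP 0 x) => x0; last by rewrite mul0r !mulr0 mul0r.
  have xb : 0 < x / beta by rewrite divr_gt0.
  rewrite (pmulr_rgt0 _ xb) t0.
  have cp : (1 + t / beta) `^ (b + a - 1) != 0 by rewrite gt_eqF// powR_gt0.
  have bp : beta `^ b != 0 by rewrite gt_eqF// powR_gt0.
  rewrite /k !powRM ?(ltW x0) ?(ltW xb) ?(ltW t0) ?(ltW c0) ?invr_ge0
    ?(ltW beta0)//.
  have -> : x `^ (b + a - 1) = x * (x `^ (b - 1) * x `^ (a - 1)).
    have xD r s : x `^ (r + s) = x `^ r * x `^ s.
      by apply: powRD; rewrite (gt_eqF x0) implybT.
    by rewrite -[X in X * _]powRr1 ?ltW// -!xD; congr (_ `^ _); ring.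
  have -> : beta^-1 `^ (b - 1) = beta / beta `^ b.
    rewrite -powR_inv1 ?ltW// -powRrM -powRN.
    rewrite -[X in _ = X * _](powRr1 (ltW beta0)) -powRD; last first.
      by rewrite (gt_eqF beta0) implybT.
    by congr (_ `^ _); ring.
  rewrite (_ : - ((1 + t / beta) * x) = - x + - (x / beta * t)); last by ring.
  rewrite expRD; field.
  by rewrite cp bp !gt_eqF.
rewrite ge0_integralZl//; last 2 first.
- apply: (measurableT_comp (f := EFin \o gamma_kernel (b + a))).
    by apply/measurable_EFinP; exact: measurable_gamma_kernel.
  by apply: measurable_funD => //; exact: measurable_funM.
- by move=> x _; rewrite lee_fin gamma_kernel_ge0.
(* Rescaling gives (1 + t / beta) * I = Gamma (b + a) for this integral I, and the finite right-hand
   side excludes an infinite I. *)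
have : (\int[@lebesgue_measure R]_x
    (gamma_kernel (b + a) ((1 + t / beta) * x + 0))%:E)%E =
    (Gamma (b + a) / (1 + t / beta))%:E.
  have := integral_gamma_kernel Gba.
  rewrite (ge0_integral_affine 0 c0); last 2 first.
  - by apply/measurable_EFinP; exact: measurable_gamma_kernel.
  - by move=> x; rewrite lee_fin gamma_kernel_ge0.
  case: (integral _ _ _) => [r| |].
  - by rewrite -EFinM => -[<-]; rewrite mulrAC divff ?mul1r ?gt_eqF.
  - by rewrite gt0_muley// lte_fin.
  - by rewrite gt0_muleNy// lte_fin.
move=> ->; rewrite -EFinM; congr (_%:E).
rewrite /k /Beta.
have -> : (1 + t / beta) `^ (b + a) =
    (1 + t / beta) * (1 + t / beta) `^ (b + a - 1).
  rewrite -[X in _ = X * _](powRr1 (ltW c0)) -powRD; last first.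
    by rewrite (gt_eqF c0) implybT.
  by congr (_ `^ _); ring.
have cp : (1 + t / beta) `^ (b + a - 1) != 0 by rewrite gt_eqF// powR_gt0.
have bp : beta `^ b != 0 by rewrite gt_eqF// powR_gt0.
field.
by rewrite cp bp !gt_eqF// addr_gt0.
Qed.

End gamma_kernel.

(** * Sums over a finite independent family *)

Section independent_family.
Context d (T : measurableType d) (R : realType) (P : probability T R).
Context (I : finType) (Z : I -> {RV P >-> R}).
Hypothesis indepZ : mutually_independent Z.

Local Notation event J A := (\bigcap_(k in [set` J%SET]) Z k @^-1` A k).

Let measurable_event (J : {set I}) (A : I -> set R) :
  (forall k, k \in J -> measurable (A k)) -> measurable (event J A).
Proof.
move=> mA; apply: fin_bigcap_measurable; first exact: finite_finset.
move=> k /= kJ; rewrite -[X in measurable X]setTI.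
by apply: measurable_funPT => //; exact: mA.
Qed.

(** Absorbs a condition on [Z i] into the family of conditions, so that the product rule or an
    induction hypothesis applies to [i |: J]. *)
Let eventU1 i (J : {set I}) (B : set R) (A : I -> set R) : i \notin J ->
  event (i |: J) (fun k => if k == i then B else A k) =
  Z i @^-1` B `&` event J A.
Proof.
move=> iJ; apply/seteqP; split => w.
  move=> H; split.
    by have := H i; rewrite /= !inE eqxx; exact.
  move=> k /= kJ; have := H k; rewrite /= !inE kJ orbT.
  have /negbTE -> : k != i by apply: contraNneq iJ => <-.
  exact.
move=> [/= ZiB H] k; rewrite /= !inE; case: eqP => [->|_] //= kJ.
exact: H.
Qed.

Let event1 i (B : set R) : event [set i] (fun=> B) = Z i @^-1` B.
Proof.
apply/seteqP; split => w; first by move=> /(_ i); rewrite /= inE; exact.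
by move=> H k /=; rewrite inE => /eqP ->.
Qed.

(** Induction on [s], for all [J] at once since the head index i moves into [J]. By
    [indep_pair_event], it suffices to treat rectangles for [Z i] and the remaining sum; there the
    induction hypothesis is used for [i |: J] and for {i}, and the product rule splits [Z i] from
    the event on [J]. *)
Lemma indep_sum_event (s : seq I) : uniq s ->
  forall (J : {set I}) (A : I -> set R) (B : set R),
  (forall k, k \in J -> k \notin s) ->
  (forall k, k \in J -> measurable (A k)) ->
  measurable B ->
  P ((fun w => \sum_(k <- s) Z k w) @^-1` B `&` event J A) =
  (P ((fun w => \sum_(k <- s) Z k w)%R @^-1` B) * P (event J A))%E.
Proof.
elim: s => [_|i s IH /= /andP[is_ us]] J A B Js mA mB.
  have -> : (fun w => \sum_(k <- [::]) Z k w) = (fun=> 0).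
    by apply/funext => w; rewrite big_nil.
  (* The empty sum is the constant 0, so its event is everything or empty. *)
  have [B0|B0] := pselect (B 0).
    rewrite (_ : _ @^-1` B = setT) ?setTI ?probability_setT ?mul1e//.
    by apply/seteqP; split.
  rewrite (_ : _ @^-1` B = set0) ?set0I ?measure0 ?mul0e//.
  by apply/seteqP; split.
have mE := measurable_event mA.
pose S w := \sum_(k <- s) Z k w.
have mS : measurable_fun [set: T] S by exact: measurable_sum.
have -> : (fun w => \sum_(k <- i :: s) Z k w) = (fun w => Z i w + S w).
  by apply/funext => w; rewrite big_cons.
pose C := (fun z : R * R => z.1 + z.2) @^-1` B.
have mC : measurable C.
  by rewrite -[C]setTI; apply: (@measurable_funD _ _ _ _ fst snd).
have iJ : i \notin J by apply/negP => /Js; rewrite inE eqxx.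
apply: (indep_pair_event (C := C)) => // A1 A2 mA1 mA2.
have PiE : P (Z i @^-1` A1 `&` event J A) =
    (P (Z i @^-1` A1) * P (event J A))%E.
  rewrite -eventU1// indepZ; last first.
    by move=> k; rewrite !inE; case: eqP => //= _; exact: mA.
  rewrite big_setU1//= eqxx (indepZ mA); congr (_ * _)%E.
  by apply: eq_bigr => k kJ; case: eqP => // ki; rewrite -ki kJ in iJ.
have -> : P (Z i @^-1` A1 `&` S @^-1` A2) =
    (P (S @^-1` A2) * P (Z i @^-1` A1))%E.
  rewrite setIC -event1 IH//.
  by move=> k; rewrite inE => /eqP ->.
rewrite -muleA -PiE -eventU1//.
rewrite [_ `&` S @^-1` _]setIC -setIA -eventU1// IH// => k; rewrite !inE.
  by case: eqP => [->|_] //= /Js; rewrite inE negb_or => /andP[].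
by case: eqP => //= _; exact: mA.
Qed.

(** The induction starts from one term: the empty sum is the constant 0, which has no density. *)
Lemma has_pdf_gamma_sum (a : I -> R) (s : seq I) : uniq s -> s != [::] ->
  (forall k, has_pdf P (Z k) (gamma_pdf (a k))) ->
  has_pdf P (fun w => \sum_(k <- s) Z k w) (gamma_pdf (\sum_(k <- s) a k)).
Proof.
move=> us s0 Za; elim: s us s0 => // i s IH /= /andP[is_ us] _.
rewrite big_cons.
rewrite (_ : (fun w => _) = (fun w => Z i w + \sum_(k <- s) Z k w)); last first.
  by apply/funext => w; rewrite big_cons.
have [->|s0] := eqVneq s [::].
  rewrite big_nil addr0 (_ : (fun w => _) = Z i)//.
  by apply/funext => w; rewrite big_nil addr0.
apply: has_pdf_gammaD => //; first exact: IH.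
move=> A B mA mB; rewrite setIC muleC -[Z i @^-1` A]event1.
by apply: indep_sum_event => // k; rewrite inE => /eqP ->.
Qed.

End independent_family.

Theorem theorem1 (d : measure_display) (T : measurableType d) (R : realType)
    (P : probability T R) (n : nat) (alpha beta : R)
    (Y : 'I_n -> {RV P >-> R}) (Yalpha : {RV P >-> R}) :
  (1 <= n)%N -> 0 < alpha -> 0 < beta ->
  mutually_independent (fun i : option 'I_n =>
    if i is Some j then Y j else Yalpha) ->
  (forall i, has_pdf P (Y i) (gamma_pdf 1)) ->
  has_pdf P Yalpha (gamma_pdf alpha) ->
  let X (i : 'I_n) (w : T) : R := beta * Y i w / Yalpha w in
  let S (w : T) : R := \sum_(i < n) X i w in
  has_pdf P S (fun x : R =>
    if 0 < x then
      x ^+ (n - 1) /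
        (beta ^+ n * Beta n%:R alpha * (1 + x / beta) `^ (n%:R + alpha))
    else 0) /\
  has_pdf P S (beta2_pdf n%:R alpha beta).
Proof.
move=> n1 alpha0 beta0 indepY Y1 Ya X S.
set Z := fun i : option 'I_n => _ in indepY.
(* All indices but [None], which is kept for [Yalpha]. *)
pose s : seq (option 'I_n) := map Some (enum 'I_n).
pose W w := \sum_(k <- s) Z k w.
have WE w : W w = \sum_(i < n) Y i w by rewrite /W /s big_map big_enum.
have us : uniq s by rewrite map_inj_uniq ?enum_uniq// => i j [].
have s0 : s != [::] by rewrite -size_eq0 size_map size_enum_ord -lt0n.
have Wn : has_pdf P W (gamma_pdf n%:R).
  have := has_pdf_gamma_sum indepY
    (a := fun k => if k is Some _ then 1 else alpha) us s0.
  rewrite big_map big_enum /= sumr_const card_ord; apply.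
  by case.
have indepW (A B : set R) : measurable A -> measurable B ->
    P (Yalpha @^-1` A `&` W @^-1` B) =
    (P (Yalpha @^-1` A) * P (W @^-1` B))%E.
  move=> mA mB; have := @indep_sum_event _ _ _ _ _ _ indepY s us
    [set None]%SET (fun=> A) B.
  rewrite (_ : \bigcap_(k in _) _ = Yalpha @^-1` A); last first.
    apply/seteqP; split => w; first by move=> /(_ None); rewrite /= inE; exact.
    by move=> H k /=; rewrite inE => /eqP ->.
  rewrite setIC muleC; apply => // k; rewrite inE => /eqP ->.
  by apply/mapP => -[].
(* The common factor beta / Yalpha comes out of the sum, leaving a single ratio of independent gamma
   variables. *)
have SE : S = (fun w => beta * W w / Yalpha w).
  by apply/funext => w; rewrite WE mulr_sumr mulr_suml.
have Sbeta2 : has_pdf P S (beta2_pdf n%:R alpha beta).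
  by rewrite SE; exact: has_pdf_gamma_ratio.
split=> //; rewrite (_ : (fun x : R => _) = beta2_pdf n%:R alpha beta)//.
apply/funext => x; rewrite /beta2_pdf; case: ifPn => // x0.
(* The truncated subtraction n - 1 is exact because 1 <= n. *)
have -> : n%:R - 1 = (n - 1)%:R :> R by rewrite natrB.
by rewrite !powR_mulrn// ltW.
Qed.
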